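(* Let $B$ be an affine $\mathbb{C}$-algebra and let $D$ be a locally nilpotent derivation of $B$. Then $\operatorname{Aut}(B)_D=\operatorname{Aut}(B)_{\exp(D)}$.
   Context: An affine $\mathbb{C}$-algebra is a finitely generated commutative $\mathbb{C}$-algebra; $\operatorname{Aut}(B)$ is the group of $\mathbb{C}$-algebra automorphisms of $B$. A derivation $D$ of $B$ (a $\mathbb{C}$-linear map satisfying the Leibniz rule) is locally nilpotent if for every $b\in B$ there is $j\ge 0$ with $D^j(b)=0$. Its exponential is the $\mathbb{C}$-algebra automorphism $\exp(D)(b)=\sum_{j\ge 0}\frac{1}{j!}D^j(b)$ of $B$. The isotropy groups are $\operatorname{Aut}(B)_D=\{\varphi\in\operatorname{Aut}(B)\mid \varphi D\varphi^{-1}=D\}$ and $\operatorname{Aut}(B)_{\exp(D)}=\{\varphi\in\operatorname{Aut}(B)\mid \varphi\exp(D)\varphi^{-1}=\exp(D)\}$. *)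

(* Defs.v *)
From mathcomp Require Import all_boot all_algebra.
From mathcomp Require Import complex.
From mathcomp Require Import boolp classical_sets fsbigop reals.
From mathcomp Require mpoly.

Set Implicit Arguments.
Unset Strict Implicit.
Unset Printing Implicit Defensive.

Import GRing.Theory.
Local Open Scope ring_scope.

(* A commutative K-algebra is given by its structure map eta : K -> B, with   *)
(* c *: b = eta c * b; MathComp's comAlgType excludes the zero ring, which    *)
(* is an affine algebra.                                                      *)
Section Algebra.
Variables (K : fieldType) (B : comPzRingType) (eta : {rmorphism K -> B}).

(* This is the body of mpoly.mmap, which itself needs a nontrivial codomain. *)
Definition mpoly_eval (n : nat) (v : 'I_n -> B) (p : mpoly.mpoly n K) : B :=
  \sum_(m <- mpoly.msupp p)
    eta (mpoly.mcoeff m p) * \prod_(i < n) v i ^+ mpoly.fun_of_multinom m i.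

Definition affine_algebra : Prop :=
  exists (n : nat) (v : 'I_n -> B), forall b : B, exists p, b = mpoly_eval v p.

Record algAut := AlgAut {
  aut_fun :> {rmorphism B -> B};
  aut_inv : B -> B;
  aut_eta : forall c : K, aut_fun (eta c) = eta c;
  aut_funK : cancel aut_fun aut_inv;
  aut_invK : cancel aut_inv aut_fun
}.

Record derivation := Derivation {
  der_fun :> {additive B -> B};
  derZ : forall (c : K) (b : B), der_fun (eta c * b) = eta c * der_fun b;
  derM : forall a b : B, der_fun (a * b) = der_fun a * b + a * der_fun b
}.

Definition locally_nilpotent (D : derivation) : Prop :=
  forall b : B, exists j : nat, iter j D b = 0.

(* The sum over all j is finite when D is locally nilpotent; for infinite     *)
(* support, \sum_(j \in _) is 0.                                              *)
Definition exp_der (D : derivation) (b : B) : B :=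
  \sum_(j \in [set: nat]%classic) eta j`!%:R^-1 * iter j D b.

Definition isotropy (T : B -> B) : set algAut :=
  [set phi : algAut | phi \o T \o aut_inv phi = T]%classic.

End Algebra.

Arguments isotropy {K B} eta T.

(* Main.v *)
Require Import Defs.
From mathcomp Require Import all_boot all_algebra complex classical_sets reals.
From mathcomp Require Import boolp fsbigop.
Local Open Scope ring_scope.

Import GRing.Theory Num.Theory.

(** If [D ^ N] kills [b], then [exp(D) ^ n b = \sum_(j < N) n ^ j / j! D ^ j b]
    is a polynomial in [n]. Inverting a Vandermonde matrix recovers its linear
    coefficient: [D b] is a combination of the [exp(D) ^ n b], with scalars
    that depend only on [N]. Hence whatever commutes with [exp(D)] commutes
    with [D]. *)

Lemma interpolate_linear_coef (K : numFieldType) (N : nat) :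
  exists w : 'I_N -> K,
    forall j : 'I_N, \sum_(n < N) w n * n%:R ^+ j = (j == 1%N :> nat)%:R.
Proof.
(* For [N <= 1] the index [j = 1] does not occur, so zero weights suffice. *)
case: N => [|[|N]]; first by exists (fun=> 0) => -[].
  by exists (fun=> 0) => j; rewrite big1 ?ord1 // => n _; rewrite mul0r.
pose a : 'rV[K]_N.+2 := \row_n n%:R.
(* The nodes [0, ..., N+1] are distinct because [K] has characteristic zero. *)
have Vunit : Vandermonde N.+2 a \in unitmx.
  rewrite unitmxE unitfE det_Vandermonde.
  apply/prodf_neq0 => i _; apply/prodf_neq0 => j lt_ij.
  by rewrite !mxE subr_eq0 eqr_nat gtn_eqF.
(* The weights form column 1 of the inverse of [V = (n ^ j)], with [j] the row index; the claim is
   column 1 of [V * V^-1 = 1]. *)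
exists (fun n => invmx (Vandermonde N.+2 a) n (inord 1)) => j.
have := congr1 (fun A : 'M_N.+2 => A j (inord 1)) (mulmxV Vunit).
rewrite !mxE -(inj_eq val_inj) /= inordK // => <-.
by apply: eq_bigr => n _; rewrite !mxE mulrC.
Qed.

Section ExpDer.
Variables (K : numFieldType) (B : comPzRingType) (eta : {rmorphism K -> B}).
Implicit Types (D : derivation eta) (phi : algAut eta).

Lemma iter_der0 D (n N : nat) (b : B) :
  (N <= n)%N -> iter N D b = 0 -> iter n D b = 0.
Proof.
move=> /subnK <- Db0; rewrite iterD Db0.
by elim: (n - N)%N => //= k ->; rewrite raddf0.
Qed.

(** Applied to [b] and [phi b], this allows both expansions to be cut at the same [N]. *)
Lemma locally_nilpotent2 D (a b : B) : locally_nilpotent D ->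
  exists N, iter N D a = 0 /\ iter N D b = 0.
Proof.
move=> nilD; have [m Da0] := nilD a; have [n Db0] := nilD b.
exists (maxn m n).
by rewrite (iter_der0 _ _ m) ?leq_maxl // (iter_der0 _ _ n) ?leq_maxr.
Qed.

Lemma exp_derE D (N : nat) (b : B) : iter N D b = 0 ->
  exp_der D b = \sum_(j < N) eta j`!%:R^-1 * iter j D b.
Proof.
move=> Db0; rewrite (fsbig_ord _ N (fun j => eta j`!%:R^-1 * iter j D b)).
apply/esym/fsbig_widen => // j [_ /= /negP].
by rewrite -leqNgt => le_Nj; rewrite (iter_der0 _ _ _ _ le_Nj Db0) mulr0.
Qed.

(** The bound [N - j] keeps only the triangle [i + j < N], outside of which [D ^ (i + j) b = 0];
    this prepares the reindexing by [k = i + j]. *)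
Lemma exp_der_sum D (N : nat) (b : B) (c : nat -> K) : iter N D b = 0 ->
  exp_der D (\sum_(j < N) eta (c j) * iter j D b) =
  \sum_(j < N) eta (c j) * \sum_(i < N - j) eta i`!%:R^-1 * iter (i + j) D b.
Proof.
move=> Db0.
have iter_sum k : iter k D (\sum_(j < N) eta (c j) * iter j D b) =
    \sum_(j < N) eta (c j) * iter (k + j) D b.
  elim: k => //= k ->; rewrite raddf_sum; apply: eq_bigr => j _.
  by rewrite derZ.
rewrite (exp_derE _ N); last first.
  rewrite iter_sum big1 // => j _.
  by rewrite (iter_der0 _ _ N) ?leq_addr // mulr0.
under eq_bigr => i _ do rewrite iter_sum mulr_sumr.
rewrite exchange_big; apply: eq_bigr => j _ /=.
rewrite mulr_sumr (big_ord_widen N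
  (fun i => eta (c j) * (eta i`!%:R^-1 * iter (i + j) D b))) ?leq_subr //.
rewrite [RHS]big_mkcond; apply: eq_bigr => i _; rewrite mulrCA.
case: ifPn => //; rewrite -leqNgt leq_subLR addnC => le_N.
by rewrite (iter_der0 _ _ _ _ le_N Db0) !mulr0.
Qed.

(** Induction on [n]: by the binomial theorem, the sum over [j <= k] of [n ^ j / (j! (k - j)!)] is
    [(n + 1) ^ k / k!]. *)
Lemma iter_exp_der D (N n : nat) (b : B) : iter N D b = 0 ->
  iter n (exp_der D) b = \sum_(j < N) eta (n%:R ^+ j / j`!%:R) * iter j D b.
Proof.
move=> Db0; elim: n => [|n IHn].
  (* Since [0 ^ 0 = 1], only the term [j = 0] survives; [N = 0] forces [b = 0]. *)
  case: N Db0 => [/= ->|N _]; first by rewrite big_ord0.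
  rewrite big_ord_recl big1 => [|j _].
    by rewrite expr0 divr1 rmorph1 mul1r addr0.
  by rewrite lift0 expr0n mul0r rmorph0 mul0r.
rewrite iterS IHn (exp_der_sum _ _ _ (fun j => n%:R ^+ j / j`!%:R)) //.
rewrite -(big_mkord xpredT (fun j => eta (n%:R ^+ j / j`!%:R) *
  \sum_(i < N - j) eta i`!%:R^-1 * iter (i + j) D b)).
(* The inner index becomes [k = i + j], and its range is widened to [0 <= k < N] under the condition
   [j <= k], so that the two sums can be exchanged. *)
under eq_bigr => j _.
  rewrite -(big_mkord xpredT (fun i => eta i`!%:R^-1 * iter (i + j) D b)).
  under eq_big_nat => i _ do rewrite -{1}(addnK j i).
  rewrite -(big_addn 0 N j xpredT (fun k => eta (k - j)`!%:R^-1 * iter k D b)).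
  rewrite add0n (big_nat_widenl _ 0) // mulr_sumr; over.
rewrite (exchange_big_dep_nat xpredT) //= big_mkord; apply: eq_bigr => k _.
rewrite -natr1 addrC exprDn mulr_suml raddf_sum /= mulr_suml.
rewrite -(big_nat_widen 0 k.+1 N xpredT) // big_mkord.
apply: eq_bigr => j _; rewrite mulrA -rmorphM expr1n mul1r.
congr (eta _ * _); have le_jk : (j <= k)%N by rewrite -ltnS.
(* With [k! = 'C(k, j) * (j! * (k - j)!)], the binomial coefficient cancels. *)
rewrite -(bin_fact le_jk) !natrM -[_ *+ 'C(k, j)]mulr_natr.
have C_neq0 : 'C(k, j)%:R != 0 :> K by rewrite pnatr_eq0 -lt0n bin_gt0.
by rewrite invfM mulrA mulfK // invfM mulrA.
Qed.

Lemma der_exp_combination D (N : nat) : exists w : 'I_N -> K,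
  forall b, iter N D b = 0 ->
    D b = \sum_(n < N) eta (w n) * iter n (exp_der D) b.
Proof.
have [w wE] := interpolate_linear_coef K N; exists w => b Db0.
under eq_bigr => n _ do rewrite (iter_exp_der _ N) // mulr_sumr.
rewrite exchange_big /=.
under eq_bigr => j _.
  under eq_bigr => n _ do rewrite mulrA -rmorphM mulrA.
  rewrite -mulr_suml -raddf_sum -mulr_suml wE; over.
(* Only [j = 1] contributes, and it gives [D b / 1!]. For [N <= 1] that term is absent, but then
   [D b = 0]. *)
case: N => [|[|N]] in w wE Db0 *.
- by rewrite big_ord0 -[LHS]/(iter 1 D b) (iter_der0 _ 1 0).
- by rewrite big_ord1 /= mulr0n mul0r rmorph0 mul0r.
rewrite 2!big_ord_recl big1 /= => [|j _].
  by rewrite mulr0n mul0r rmorph0 mul0r add0r addr0 divr1 rmorph1 mul1r.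
by rewrite mulr0n mul0r rmorph0 mul0r.
Qed.

Lemma in_isotropyE phi (T : B -> B) :
  isotropy eta T phi <-> {morph phi : b / T b}.
Proof.
split=> [/= phiT b|phiT]; last by apply/funext => b /=; rewrite phiT aut_invK.
by rewrite -[in RHS]phiT /= aut_funK.
Qed.

Lemma morph_exp_der D phi : locally_nilpotent D ->
  {morph phi : b / D b} -> {morph phi : b / exp_der D b}.
Proof.
move=> nilD phiD b; have [N [Db0 Dpb0]] := locally_nilpotent2 D b (phi b) nilD.
rewrite !(exp_derE _ N) // rmorph_sum; apply: eq_bigr => j _ /=.
rewrite rmorphM aut_eta; congr (_ * _).
by elim: (j : nat) => //= k <-.
Qed.

(** The same weights express [D b] and [D (phi b)]; [phi] fixes them and commutes with every power
    of [exp(D)], so the two combinations agree term by term. *)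
Lemma morph_der_exp D phi : locally_nilpotent D ->
  {morph phi : b / exp_der D b} -> {morph phi : b / D b}.
Proof.
move=> nilD phiE b; have [N [Db0 Dpb0]] := locally_nilpotent2 D b (phi b) nilD.
have [w wE] := der_exp_combination D N.
rewrite !wE // rmorph_sum; apply: eq_bigr => n _ /=.
rewrite rmorphM aut_eta; congr (_ * _).
by elim: (n : nat) => //= k <-.
Qed.

End ExpDer.

Theorem proposition4p4 (R : realType) (B : comPzRingType)
  (eta : {rmorphism R[i] -> B}) (D : derivation eta) :
  affine_algebra eta -> locally_nilpotent D ->
  isotropy eta D = isotropy eta (exp_der D).
Proof.
move=> _ nilD; apply/seteqP; split=> phi /in_isotropyE phiT;
  apply/in_isotropyE; [exact: morph_exp_der|exact: morph_der_exp].
Qed.
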